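(* Let $K,i,\kappa$ be positive integers and $\epsilon\in\{0,1\}$ such that $K>2$, $K=2\kappa-\epsilon$ and $1\le i\le\kappa$. Define the formal series $$G_{K,i}(z;q)=\sum_{m_1,m_2,\dots,m_{K-1}=0}^{\infty}\frac{q^{\frac12(\tilde N_1^2+\tilde N_2^2+\cdots+\tilde N_{K-1}^2+\tilde M)+\tilde L_{2i}}\,z^{\tilde N}}{(q)_{m_1}(q)_{m_2}\cdots(q)_{m_{K-1}}},$$ where $$\tilde N_j=m_j+m_{j+1}+\cdots+m_{K-1},\qquad \tilde L_{2i}=m_{2i}+m_{2i+1}+2(m_{2i+2}+m_{2i+3})+3(m_{2i+4}+m_{2i+5})+\cdots,$$ $$\tilde M=m_1+m_3+\cdots+m_{K-1-\epsilon},\qquad \tilde N=m_1+2m_2+\cdots+(K-1)m_{K-1},$$ with $m_l=0$ for $l\ge K$. Let $$J_{K,i}(z;q)=\sum_{n,m\ge0}J_{K,i}(n,m)\,q^nz^m ,$$ where $J_{K,i}(n,m)$ is the number of $K$-restricted jagged partitions $(n_1,\dots,n_m)$ of length $m$ with $\sum_j n_j=n$ containing at most $i-1$ pairs $01$. Then $$G_{K,i}(z;q)=J_{K,i}(z;q).$$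
   Context: **Notation.** $(q)_n=\prod_{l=1}^{n}(1-q^l)$, $(q)_0=1$. In $\tilde M$ the sum runs over all odd indices between $1$ and $K-1-\epsilon$ (which is odd). **Jagged partitions.** A jagged partition of length $m$ is a sequence of non-negative integers $(n_1,\dots,n_m)$ with $n_j\ge n_{j+1}-1$ (for $1\le j\le m-1$), $n_j\ge n_{j+2}$ (for $1\le j\le m-2$), and $n_m\ge 1$. For $m=0$ the only one is the empty sequence. It is $K$-restricted if for every $1\le j\le m-K+1$ either $$n_j\ge n_{j+K-1}+1\qquad\text{or}\qquad n_j=n_{j+1}-1=n_{j+K-2}+1=n_{j+K-1}.$$ A pair $01$ is an index $j$ with $(n_j,n_{j+1})=(0,1)$. *)

(* Defs.v *)
From mathcomp Require Import all_boot all_order all_algebra.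
From mathcomp Require Import zify.
From mathcomp Require Import boolp classical_sets functions cardinality fsbigop.

Set Implicit Arguments.
Unset Strict Implicit.
Unset Printing Implicit Defensive.

Import Order.TTheory GRing.Theory Num.Theory.
Local Open Scope classical_set_scope.
Local Open Scope ring_scope.

(* A formal power series in one variable is the function giving its
   coefficients. *)
Definition fps (R : Type) := nat -> R.

Definition fps_of_poly (R : nzRingType) (p : {poly R}) : fps R :=
  fun n => p`_n.

Definition fps_mul (R : nzRingType) (a b : fps R) : fps R :=
  fun n => \sum_(k < n.+1) a k * b (n - k)%N.

(* The coefficients 0, ..., n of the inverse of a, from the recurrence
   b_0 = a_0^-1,  b_(n+1) = - a_0^-1 * (a_1 b_n + ... + a_(n+1) b_0). *)
Fixpoint fps_inv_seq (R : unitRingType) (a : fps R) (n : nat) : seq R :=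
  if n is n'.+1 then
    let s := fps_inv_seq a n' in
    rcons s (- (a 0%N)^-1 * \sum_(k < n'.+1) a k.+1 * s`_(n' - k))
  else [:: (a 0%N)^-1].

(* Meaningful when a 0 is a unit, see fps_mulV. *)
Definition fps_inv (R : unitRingType) (a : fps R) : fps R :=
  fun n => (fps_inv_seq a n)`_n.

Lemma size_fps_inv_seq (R : unitRingType) (a : fps R) n :
  size (fps_inv_seq a n) = n.+1.
Proof. by elim: n => //= n IHn; rewrite size_rcons IHn. Qed.

Lemma nth_fps_inv_seq (R : unitRingType) (a : fps R) n k : (k <= n)%N ->
  (fps_inv_seq a n)`_k = fps_inv a k.
Proof.
elim: n => [|n IHn] lekn; first by move: lekn; rewrite leqn0 => /eqP ->.
move: lekn; rewrite leq_eqVlt => /predU1P[-> //|ltkn].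
by rewrite /= nth_rcons size_fps_inv_seq ltkn IHn.
Qed.

Lemma fps_mulV (R : unitRingType) (a : fps R) : a 0%N \is a GRing.unit ->
  fps_mul a (fps_inv a) = fps_of_poly 1.
Proof.
move=> ua; apply/funext => -[|n]; rewrite /fps_mul /fps_of_poly coef1.
  by rewrite big_ord1 /fps_inv /= mulrV.
rewrite big_ord_recl subn0 {1}/fps_inv /= nth_rcons size_fps_inv_seq ltnn eqxx.
rewrite mulrA mulrN mulrV // mulN1r addrC; apply/eqP; rewrite subr_eq0.
apply/eqP/eq_bigr => k _; rewrite /bump /= add1n subSS.
by rewrite nth_fps_inv_seq // leq_subr.
Qed.

(* A formal power series in q and z: f n m is the coefficient of q^n z^m. *)
Definition qzseries := nat -> nat -> int.

(* a(q) z^d *)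
Definition qz_mulXz (a : fps int) (d : nat) : qzseries :=
  fun n m => if m == d then a n else 0.

(* (q)_n, with 'X for q *)
Definition qfact (n : nat) : {poly int} := \prod_(1 <= l < n.+1) (1 - 'X^l).

(* The l-th entry of s, counted from 1, and 0 for l > size s. *)
Definition entry (s : seq nat) (l : nat) : nat := nth 0%N s l.-1.

Section MultiSum.
Variables (K : nat) (m : seq nat).

Definition Nt_ (j : nat) : nat := (\sum_(j <= l < K) entry m l)%N.

(* The series ends by itself since entry m l = 0 for l >= K when
   size m = K - 1; the bound k < K omits no nonzero summand for i > 0. *)
Definition Lt_ (i : nat) : nat :=
  (\sum_(1 <= k < K)
     k * (entry m (2 * (i + k - 1)) + entry m (2 * (i + k - 1)).+1))%N.

Definition Mt (eps : nat) : nat := (\sum_(1 <= j < K - eps | odd j) entry m j)%N.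

Definition Nt : nat := (\sum_(1 <= j < K) j * entry m j)%N.

Definition quadt (eps : nat) : nat :=
  ((\sum_(1 <= j < K) Nt_ j ^ 2) + Mt eps)%N.

(* The halving is exact, see quadt_even. *)
Definition expt (eps i : nat) : nat := ((quadt eps)./2 + Lt_ i)%N.

Definition Gterm (eps i : nat) : qzseries :=
  qz_mulXz
    (fps_mul (fps_of_poly 'X^(expt eps i))
       (fps_inv (fps_of_poly (\prod_(1 <= j < K) qfact (entry m j)))))
    Nt.

End MultiSum.

(* The sum over all (m_1, ..., m_(K-1)), coefficient by coefficient; only
   finitely many summands contribute to each coefficient, see Gterm_finite. *)
Definition Gseries (K eps i : nat) : qzseries := fun n k =>
  \sum_(m \in [set: (K.-1).-tuple nat]) Gterm K m eps i n k.

Definition jagged (s : seq nat) : bool :=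
  [&& all (fun j => entry s j.+1 - 1 <= entry s j)%N (iota 1 (size s - 1)),
      all (fun j => entry s j.+2 <= entry s j)%N (iota 1 (size s - 2)) &
      (s == [::]) || (1 <= entry s (size s))%N].

(* For K > 0, j ranges over 1 <= j <= size s - K + 1. *)
Definition restricted (K : nat) (s : seq nat) : bool :=
  all (fun j =>
         (entry s (j + K - 1) + 1 <= entry s j)%N
      || [&& entry s j + 1 == entry s j.+1,
             entry s j == entry s (j + K - 2) + 1 &
             entry s j == entry s (j + K - 1)]%N)
      (iota 1 ((size s).+1 - K)).

Definition pairs01 (s : seq nat) : nat :=
  count (fun j => (entry s j == 0) && (entry s j.+1 == 1))%N
        (iota 1 (size s - 1)).

(* The entries of a sequence of sum n are at most n, so that 'I_n.+1 does not
   restrict the count. *)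
Definition Jcount (K i n m : nat) : nat :=
  #|[set t : m.-tuple 'I_n.+1 | let s := map val t in
      [&& jagged s, restricted K s, sumn s == n & (pairs01 s <= i - 1)%N]]%SET|.

Definition Jseries (K i : nat) : qzseries := fun n m => (Jcount K i n m)%:Z.

Lemma sum_Nt_ K m : (\sum_(1 <= j < K) Nt_ K m j)%N = Nt K m.
Proof.
rewrite /Nt; elim: K => [|[|K] IHK]; [by rewrite !big_geq|by rewrite !big_geq|].
rewrite big_nat_recr //= [RHS]big_nat_recr //= -IHK.
have NtS j : (1 <= j < K.+1)%N -> Nt_ K.+2 m j = (Nt_ K.+1 m j + entry m K.+1)%N.
  by move=> /andP[_ jK]; rewrite /Nt_ big_nat_recr // ltnW.
rewrite (eq_big_nat _ _ NtS) big_split /= sum_nat_const_nat subn1 /=.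
by rewrite {2}/Nt_ big_nat1 mulSn -!addnA [(K * _ + _)%N]addnC.
Qed.

Lemma entry_le_Nt K (m : seq nat) j : (1 <= j < K)%N ->
  (entry m j <= Nt K m)%N.
Proof.
move=> jK; rewrite /Nt (bigD1_seq j) ?mem_index_iota ?iota_uniq //=.
apply: leq_trans (leq_addr _ _); apply: leq_pmull.
by case/andP: jK.
Qed.

Lemma Gterm_finite (K eps i n k : nat) :
  finite_set [set m : (K.-1).-tuple nat | Gterm K m eps i n k != 0].
Proof.
pose f (t : (K.-1).-tuple 'I_k.+1) : (K.-1).-tuple nat := [tuple of map val t].
apply: (@sub_finite_set _ _ (range f)); last first.
  by apply: finite_image; exact: finite_finset.
move=> m /=; rewrite /Gterm /qz_mulXz; case: (k =P Nt K m) => [kE _|_]; last first.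
  by rewrite eqxx.
exists [tuple of map inord m] => //; apply: val_inj => /=.
rewrite -map_comp -[RHS]map_id; apply/eq_in_map => x /(nthP 0%N)[j].
rewrite size_tuple => jK <- /=; rewrite inordK // ltnS kE.
have -> : nth 0%N m j = entry m j.+1 by [].
by apply: entry_le_Nt; case: (K) jK.
Qed.

Lemma quadt_even (K kappa eps : nat) (m : seq nat) : (eps <= 1)%N ->
  (K = 2 * kappa - eps)%N -> (0 < kappa)%N -> ~~ odd (quadt K m eps).
Proof.
move=> eps1 KE kappa0; rewrite /quadt /Mt.
have -> : (\sum_(1 <= j < K - eps | odd j) entry m j =
           \sum_(1 <= j < K | odd j) entry m j)%N.
  case: eps eps1 KE => [|[|//]] _ KE; first by rewrite subn0.
  case: kappa kappa0 KE => [//|[|kappa]] _ KE; first by rewrite KE !big_geq.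
  have [c Kc co] : exists2 c, K = c.+2 & ~~ odd c.+1.
    by exists (2 * kappa).+1%N; [lia | rewrite /= !negbK mul2n odd_double].
  rewrite Kc subn1 succnK big_mkcond [RHS]big_mkcond [RHS]big_nat_recr //.
  by rewrite (negbTE co) [RHS]addn0.
have oddS := big_morph odd oddD (erefl : odd 0 = false).
rewrite oddD !oddS; under eq_bigr do rewrite oddX /=.
rewrite -oddS sum_Nt_ /Nt oddS; under eq_bigr do rewrite oddM.
rewrite [X in _ (+) X]big_mkcond -big_split /= big1 // => j _.
by case: (odd j) => //=; rewrite addbb.
Qed.

(* Main.v *)
Require Import Defs.
From mathcomp Require Import all_boot all_order all_algebra.
From mathcomp Require Import zify ring.
From mathcomp Require Import boolp classical_sets functions fsbigop.
From HB Require Import structures.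

Set Implicit Arguments.
Unset Strict Implicit.
Unset Printing Implicit Defensive.

Import Order.TTheory GRing.Theory Num.Theory.
Local Open Scope ring_scope.

(** Let k = K - 1. Both sides of the theorem belong to families of series in z
    that solve one and the same triangular system of q-difference equations,
    and that system has a single solution.

    Combinatorial side. The zeros of a jagged partition all lie in a final
    block 01 01 ... 01; in front of it stands a jagged partition t without 0,
    and t is obtained from an arbitrary jagged partition s by adding 1 to every
    entry and appending some 1's. The K-restriction passes through both
    steps: appending c pairs 01 to t costs exactly the condition
    (number of final 1's of t) + 2c <= k (restricted_tail01), and lifting s and
    appending b entries 1 costs exactly 2 (number of pairs 01 of s) + b <= k
    (restricted_lift1). So let A_i(z) count the restricted jagged partitions
    with fewer than i pairs 01, and E_b(z) those that have no entry 0 and fewer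
    than b final 1's. Sorting by the exact number of pairs, respectively of
    final 1's, gives (count_ladder)
      A_(i+1)(z) = A_i(z) + q^i z^(2i) E_(k+1-2i)(z),
      E_(b+1)(z) = E_b(z) + q^b z^b A_(floor((k+2-b)/2))(zq),
    with A_0 = E_0 = 0. As the second relation replaces z by zq, it expresses
    each coefficient through coefficients of smaller q-degree, so that the
    system and the constant terms in z determine everything (ladder_unique).

    Multisum side. Splitting off the sum over n = m_k turns the k-fold sum into
      sum_n q^(h(n) + t n) z^(kn) / (q)_n * f(z q^n),
    where f is a (k-1)-fold sum, h(n) = (k n^2 + [k odd] n) / 2 and t is the
    coefficient of m_k in the linear form of the exponent. This operator, peel,
    commutes with multiplication by q^a z^s and with z -> zq up to a shift of t
    (peel_mon, dil_peel), and (1 - q^n) / (q)_n = 1 / (q)_(n-1) relates its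
    values at t and t + 1 (peelS). These rules alone carry the system from k-1
    to k (multisum_ladder). The induction needs the companion family E_b on
    this side too; it is obtained by the same operator with another linear
    form. *)

(** * Power series form a commutative ring *)

Section FpsRing.
Variable R : comNzRingType.
Implicit Types a b c : fps R.

(** Up to any given degree the Cauchy product is a product of polynomials, from
    which it inherits its laws. *)
Definition fps_trunc N a : {poly R} := \poly_(j < N) a j.

Lemma fps_mul_trunc N a b n : (n < N)%N ->
  fps_mul a b n = (fps_trunc N a * fps_trunc N b)`_n.
Proof.
move=> nN; rewrite coefM /fps_mul; apply: eq_bigr => k _.
by rewrite !coef_poly !ifT //; have := ltn_ord k; lia.
Qed.

Lemma coef_mul_congr (p p' r : {poly R}) n :
  (forall j, (j <= n)%N -> p`_j = p'`_j) -> (p * r)`_n = (p' * r)`_n.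
Proof. by move=> pp'; rewrite !coefM; apply: eq_bigr => k _; rewrite pp' // -ltnS. Qed.

Lemma fps_mulC : commutative (@fps_mul R).
Proof.
by move=> a b; apply/funext => n; rewrite !(@fps_mul_trunc n.+1) // mulrC.
Qed.

Lemma fps_mulA : associative (@fps_mul R).
Proof.
have trM N a b j : (j < N)%N ->
    (fps_trunc N (fps_mul a b))`_j = (fps_trunc N a * fps_trunc N b)`_j.
  by move=> jN; rewrite coef_poly jN (fps_mul_trunc _ _ jN).
move=> a b c; apply/funext => n; rewrite !(@fps_mul_trunc n.+1) //.
set ta := fps_trunc n.+1 a; set tb := fps_trunc n.+1 b; set tc := fps_trunc n.+1 c.
rewrite [ta * _]mulrC [LHS](@coef_mul_congr _ (tb * tc)) => [|j jn]; last exact: trM.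
rewrite [RHS](@coef_mul_congr _ (ta * tb)) => [|j jn]; last exact: trM.
by rewrite [tb * tc * ta]mulrC mulrA.
Qed.

Lemma fps_mul1 : left_id (fps_of_poly (1 : {poly R})) (@fps_mul R).
Proof.
move=> a; apply/funext => n; rewrite /fps_mul big_ord_recl /fps_of_poly coef1 mul1r.
by rewrite subn0 big1 ?addr0 // => j _; rewrite coef1 mul0r.
Qed.

Lemma fps_mulDl : left_distributive (@fps_mul R) (fun a b : fps R => (a : nat -> R) + b).
Proof.
move=> a b c; apply/funext => n; rewrite /fps_mul -[RHS]big_split /=.
by apply: eq_bigr => j _; rewrite -mulrDl.
Qed.

Lemma fps_1neq0 : fps_of_poly (1 : {poly R}) != (0 : nat -> R).
Proof.
apply/eqP => /(congr1 (fun f => f 0%N)); rewrite /fps_of_poly coef1 /= => /eqP.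
by rewrite oner_eq0.
Qed.

HB.instance Definition _ := GRing.Zmodule.copy (fps R) (nat -> R).
HB.instance Definition _ := GRing.Zmodule_isComNzRing.Build (fps R)
  fps_mulA fps_mulC fps_mul1 fps_mulDl fps_1neq0.

Lemma fps_mulE a b : a * b = fps_mul a b.
Proof. by []. Qed.

Lemma fps_of_polyM (p r : {poly R}) :
  fps_of_poly (p * r) = fps_of_poly p * fps_of_poly r.
Proof. by apply/funext => n; rewrite /fps_of_poly coefM. Qed.

Lemma fps_of_poly1 : fps_of_poly (1 : {poly R}) = 1.
Proof. by []. Qed.

Lemma fps_sumE (I : Type) (r : seq I) (P : pred I) (F : I -> fps R) n :
  (\sum_(j <- r | P j) F j) n = \sum_(j <- r | P j) F j n.
Proof. exact: (big_morph (fun f : fps R => f n)). Qed.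

Definition fps_X : fps R := fps_of_poly 'X.

Lemma fps_X_exp e : fps_X ^+ e = fps_of_poly 'X^e.
Proof. by elim: e => // e IHe; rewrite !exprS fps_of_polyM IHe. Qed.

Lemma fps_coefXnM e a n :
  (fps_X ^+ e * a) n = if (e <= n)%N then a (n - e)%N else 0.
Proof.
rewrite fps_X_exp fps_mulE (@fps_mul_trunc n.+1) //.
rewrite (@coef_mul_congr _ 'X^e) => [|j jn].
  by rewrite coefXnM coef_poly ltnS leq_subr; case: ltnP.
by rewrite coef_poly ltnS jn.
Qed.

End FpsRing.

(** * A system of q-difference equations *)

Lemma addfE (T : Type) (V : zmodType) (f g : T -> V) x : (f + g) x = f x + g x.
Proof. by []. Qed.

(** Series in z are functions giving the coefficients, here in an arbitrary
    commutative ring with a distinguished element q. *)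
Section Relations.
Variables (R : comNzRingType) (q : R).

(** The series q^a z^s f(z). *)
Definition mon a s (f : nat -> R) : nat -> R :=
  fun m => if (s <= m)%N then q ^+ a * f (m - s)%N else 0.

(** The series f(zq). *)
Definition dil (f : nat -> R) : nat -> R := fun m => q ^+ m * f m.

(** Truncated subtraction makes the relations meaningful for all i and b: beyond
    the range of k the right-hand index is 0, so that A i and E b become
    constant there. *)
Definition ladder k (A E : nat -> nat -> R) : Prop :=
  [/\ A 0%N = 0, E 0%N = 0,
      forall i, A i.+1 = A i + mon i (2 * i) (E (k.+1 - 2 * i)%N)
    & forall b, E b.+1 = E b + mon b b (dil (A (k.+2 - b)./2))].

Lemma monD a s f g : mon a s (f + g) = mon a s f + mon a s g.
Proof.
apply/funext => m; rewrite /mon !addfE; case: leqP => _; last by rewrite addr0.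
by rewrite mulrDr.
Qed.

Lemma mon0 a s : mon a s 0 = 0.
Proof. by apply/funext => m; rewrite /mon; case: leqP => // _; rewrite mulr0. Qed.

Lemma mon_mon a s a' s' f : mon a s (mon a' s' f) = mon (a + a') (s + s') f.
Proof.
apply/funext => m; rewrite /mon; case: leqP => sm; last by rewrite ifF //; lia.
rewrite leq_subRL // -subnDA; case: leqP => _; last by rewrite mulr0.
by rewrite mulrA -exprD.
Qed.

Lemma dil0 : dil 0 = 0.
Proof. by apply/funext => m; rewrite /dil mulr0. Qed.

(** * The operator that adds one summation variable *)

Section Multisum.
(* Stands for the sequence 1 / (q)_n. *)
Variable u : nat -> R.
Hypothesis u_rec : forall n, (1 - q ^+ n.+1) * u n.+1 = u n.

(** The new variable n raises each of N_1, ..., N_k by n, and the sum over odd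
    indices by n when k is odd; this is the part of half the quadratic form
    that depends on n alone. *)
Definition halfquad k n : nat := ((k * n ^ 2 + odd k * n)./2)%N.

Lemma halfquadS k n : halfquad k n.+1 = (halfquad k n + k * n + uphalf k)%N.
Proof.
rewrite /halfquad uphalf_half.
have -> : (k * n.+1 ^ 2 + odd k * n.+1 =
   (k * n ^ 2 + odd k * n) + (k * n + (odd k + k./2)).*2)%N.
  by have := odd_double_half k; lia.
by rewrite halfD doubleK odd_double andbF; lia.
Qed.

(** The contribution of n to the coefficient of z^m; the mixed term of the
    quadratic form is the power of q in f(z q^n). *)
Definition peel_term k t f m n : R :=
  if (k * n <= m)%N
  then q ^+ (halfquad k n + t * n + n * (m - k * n)) * u n * f (m - k * n)%N
  else 0.

(** For k > 0 only the n with k n <= m contribute, so the bound n <= m loses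
    nothing. *)
Definition peel k t f : nat -> R := fun m => \sum_(n < m.+1) peel_term k t f m n.

Lemma peel_widen k t f m N : (0 < k)%N -> (m <= N)%N ->
  peel k t f m = \sum_(n < N.+1) peel_term k t f m n.
Proof.
move=> k0 mN; rewrite /peel (big_ord_widen N.+1) //.
rewrite [LHS]big_mkcond; apply: eq_bigr => n _; rewrite ltnS.
case: leqP => // mn; rewrite /peel_term ifF //; nia.
Qed.

Lemma peelD k t f g : peel k t (f + g) = peel k t f + peel k t g.
Proof.
apply/funext => m; rewrite addfE /peel -big_split; apply: eq_bigr => n _.
by rewrite /peel_term; case: leqP => _ /=; [rewrite -mulrDr | rewrite addr0].
Qed.

Lemma peel0 k t : peel k t 0 = 0.
Proof.
apply/funext => m; rewrite /peel big1 // => n _.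
by rewrite /peel_term; case: leqP => // _; rewrite mulr0.
Qed.

(** The factor z^s of f(z) becomes z^s q^(sn) in f(z q^n). *)
Lemma peel_mon k t a s f : (0 < k)%N ->
  peel k t (mon a s f) = mon a s (peel k (t + s) f).
Proof.
move=> k0; apply/funext => m; rewrite /mon.
case: (leqP s m) => sm; last first.
  rewrite /peel big1 // => n _; rewrite /peel_term; case: leqP => // _.
  by rewrite ifF ?mulr0 //; lia.
rewrite [peel k (t + s) f _](@peel_widen _ _ _ _ m) ?leq_subr // mulr_sumr; apply: eq_bigr => n _.
rewrite /peel_term; case: (leqP (k * n) (m - s)) => le1; last first.
  rewrite mulr0; case: leqP => // le2; rewrite ifF ?mulr0 //; lia.
have [le2 le3] : (k * n <= m /\ s <= m - k * n)%N by lia.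
rewrite le2 le3 (_ : m - k * n - s = m - s - k * n)%N; last by lia.
have -> : (halfquad k n + t * n + n * (m - k * n) =
           halfquad k n + (t + s) * n + n * (m - s - k * n))%N by nia.
by ring.
Qed.

(** Replacing z by zq in z^(kn) f(z q^n) produces q^(kn). *)
Lemma dil_peel k t f : dil (peel k t f) = peel k (t + k) (dil f).
Proof.
apply/funext => m; rewrite /dil /peel mulr_sumr; apply: eq_bigr => n _.
rewrite /peel_term; case: leqP => le1; last by rewrite mulr0.
have -> : q ^+ m = q ^+ (k * n) * q ^+ (m - k * n) by rewrite -exprD subnKC.
have -> : (halfquad k n + (t + k) * n + n * (m - k * n) =
           k * n + (halfquad k n + t * n + n * (m - k * n)))%N by nia.
by rewrite [q ^+ (k * n + _)]exprD; ring.
Qed.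

(** In the difference of the two sums the n-th term carries
    (1 - q^n) / (q)_n = 1 / (q)_(n-1), and shifting n by one gives back the
    operator itself. *)
Lemma peelS k t f : (0 < k)%N ->
  peel k t f = peel k t.+1 f + mon (uphalf k + t) k (dil (peel k t f)).
Proof.
move=> k0; apply/funext => m; rewrite addfE; apply/eqP.
rewrite -subr_eq0 opprD addrA subr_eq0; apply/eqP.
rewrite {1 2}/peel -sumrB.
have Bn n : peel_term k t f m n - peel_term k t.+1 f m n =
    if (k * n <= m)%N then q ^+ (halfquad k n + t * n + n * (m - k * n)) *
      ((1 - q ^+ n) * u n) * f (m - k * n)%N else 0.
  rewrite /peel_term; case: leqP => _; last by rewrite subr0.
  have -> : (halfquad k n + t.+1 * n + n * (m - k * n) =
    n + (halfquad k n + t * n + n * (m - k * n)))%N by lia.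
  by rewrite [q ^+ (n + _)]exprD; ring.
under eq_bigr do rewrite Bn.
rewrite big_ord_recl /= muln0 /= expr0 subrr mul0r mulr0 mul0r add0r.
under eq_bigr => n _ do rewrite /bump /= add1n u_rec.
rewrite /mon; case: leqP => km; last first.
  by rewrite big1 // => n _; rewrite ifF //; nia.
rewrite /dil (@peel_widen _ _ _ _ m.-1) //; last by lia.
rewrite prednK; last by lia.
rewrite !mulr_sumr; apply: eq_bigr => n _; rewrite /peel_term.
case: (leqP (k * n) (m - k)) => le1; last by rewrite ifF ?mulr0 //; nia.
have -> : (k * n.+1 <= m)%N by nia.
rewrite (_ : m - k * n.+1 = m - k - k * n)%N; last by nia.
rewrite halfquadS.
have -> : (halfquad k n + k * n + uphalf k + t * n.+1 + n.+1 * (m - k - k * n) =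
  uphalf k + t + (m - k) + (halfquad k n + t * n + n * (m - k - k * n)))%N by nia.
by rewrite !exprD; ring.
Qed.

Definition z_one : nat -> R := fun m => (m == 0%N)%:R.

(** floor(k/2) + 1 - i, truncated at 0, is the coefficient of m_k in L_(2i). *)
Fixpoint multisumA k i : nat -> R :=
  if k is p.+1 then peel k (k./2.+1 - i) (multisumA p i)
  else if i is 0%N then 0 else z_one.

(** The first relation of the system forces the exponent floor(k/2) + i at
    b = k + 1 - 2i; rounding gives the other parity, b = k + 2 - 2i, the same
    exponent. *)
Fixpoint multisumE k b : nat -> R :=
  if k is p.+1 then peel k (k./2 + (k.+2 - b)./2) (multisumE p b)
  else if b is 0%N then 0 else z_one.

Lemma dil_z_one : dil z_one = z_one.
Proof.
by apply/funext => -[|m]; rewrite /dil /z_one /= ?mulr0 // expr0 mulr1.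
Qed.

Lemma mon00 f : mon 0 0 f = f.
Proof. by apply/funext => m; rewrite /mon subn0 expr0 mul1r. Qed.

(** In the induction step the relations for k - 1 are peeled term by term. Where
    the exponents of two consecutive members differ by 1, peelS adds a term with
    z^k; by the other relation for k - 1, this term raises the index on the right
    by one, as the passage from k - 1 to k requires. *)
Lemma multisum_ladder k : ladder k (multisumA k) (multisumE k).
Proof.
elim: k => [|p [A0 E0 RA RE]].
  split=> // [[|i]|[|[|b]]] /=.
  - by rewrite mon00 add0r.
  - by rewrite mon0 addr0.
  - by rewrite mon00 dil_z_one add0r.
  - by rewrite dil0 mon0 addr0.
  - by rewrite dil0 mon0 addr0.
split; rewrite /= ?A0 ?E0 ?peel0 //.
(* For 2i > k both sides have already reached their final value. *)
- move=> i; have [ik|ki] := leqP (2 * i) p.+1; last first.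
    rewrite (_ : p.+2 - 2 * i = 0)%N ?E0 ?peel0 ?mon0 ?addr0; last by lia.
    rewrite (RA i) (_ : p.+1 - 2 * i = 0)%N ?E0 ?peel0 ?mon0 ?addr0; last by lia.
    by congr (peel _ _ _); lia.
  set t := (uphalf p - i)%N.
  have -> : ((uphalf p).+1 - i.+1 = t)%N by rewrite /t; lia.
  have -> : ((uphalf p).+1 - i = t.+1)%N by rewrite /t; lia.
  rewrite RA peelD [peel _ t (multisumA p i)]peelS // -addrA; congr (_ + _).
  rewrite peel_mon //.
  have -> : (p.+2 - 2 * i = (p.+1 - 2 * i).+1)%N by lia.
  rewrite RE peelD monD addrC.
  have -> : (uphalf p + (p.+3 - (p.+1 - 2 * i).+1)./2 = t + 2 * i)%N.
    by rewrite /t; lia.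
  congr (_ + _).
  rewrite peel_mon // mon_mon dil_peel.
  have -> : ((p.+2 - (p.+1 - 2 * i))./2 = i)%N by lia.
  congr (mon _ _ (peel _ _ _)); rewrite /t; lia.
- move=> b; have [bk|kb] := leqP b p.+1; last first.
    rewrite (_ : (p.+3 - b)./2 = 0)%N ?A0 ?peel0 ?dil0 ?mon0 ?addr0; last by lia.
    rewrite (RE b) (_ : (p.+2 - b)./2 = 0)%N ?A0 ?dil0 ?mon0 ?addr0; last by lia.
    by congr (peel _ _ _); lia.
  rewrite (RE b) peelD dil_peel.
  have -> : ((p.+3 - b.+1)./2 = (p.+2 - b)./2)%N by [].
  set c := (p.+2 - b)./2.
  (* The exponents at b and b + 1 agree exactly when k - b is odd. *)
  have [od|ev] := boolP (odd (p.+1 - b)).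
    have -> : ((p.+3 - b)./2 = c)%N by rewrite /c; lia.
    by rewrite peel_mon //; congr (_ + mon _ _ (peel _ _ _)); rewrite /c; lia.
  have -> : ((p.+3 - b)./2 = c.+1)%N by rewrite /c; lia.
  rewrite [peel _ (uphalf p + c) (multisumE p b)]peelS // addnS -addrA.
  congr (_ + _).
  rewrite RA.
  have -> : dil (multisumA p c + mon c (2 * c) (multisumE p (p.+1 - 2 * c))) =
     dil (multisumA p c) + dil (mon c (2 * c) (multisumE p (p.+1 - 2 * c))).
    by apply/funext => m; rewrite /dil !addfE mulrDr.
  have dil_mon a s f : dil (mon a s f) = mon (a + s) s (dil f).
    apply/funext => m; rewrite /dil /mon; case: leqP => sm; last by rewrite mulr0.
    by rewrite -{1}(subnKC sm) !exprD; ring.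
  rewrite dil_mon peelD monD addrC !peel_mon // dil_peel mon_mon.
  have -> : (p.+1 - 2 * c = b)%N by rewrite /c; lia.
  congr (mon _ _ (peel _ _ _) + mon _ _ (peel _ _ _)); rewrite /c; lia.
Qed.

End Multisum.
End Relations.

(** * Peeling the sum over (m_1, ..., m_(K-1)) *)

Section Inverse.
Variable R : comUnitRingType.
Implicit Types a b : fps R.

Lemma fps_invK a : a 0%N \is a GRing.unit -> a * fps_inv a = 1.
Proof. exact: fps_mulV. Qed.

Lemma fps_coef0M a b : (a * b) 0%N = a 0%N * b 0%N.
Proof. by rewrite fps_mulE /fps_mul big_ord1 subn0. Qed.

Lemma fps_invM a b : a 0%N \is a GRing.unit -> b 0%N \is a GRing.unit ->
  fps_inv (a * b) = fps_inv a * fps_inv b.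
Proof.
move=> ua ub; have uab : (a * b) 0%N \is a GRing.unit.
  by rewrite fps_coef0M unitrM ua.
have : fps_inv a * fps_inv b * ((a * b) * fps_inv (a * b)) =
       fps_inv a * fps_inv b by rewrite fps_invK // mulr1.
rewrite (_ : _ * _ * _ = (a * fps_inv a) * (b * fps_inv b) * fps_inv (a * b)).
  by rewrite !fps_invK // !mul1r.
by ring.
Qed.

End Inverse.

Definition invqfact n : fps int := fps_inv (fps_of_poly (qfact n)).

Lemma qfact_coef0 n : (qfact n)`_0 = 1.
Proof.
rewrite /qfact coef0_prod big_nat_cond big1 // => l /andP[/andP[l0 _] _].
by rewrite coefB coef1 coefXn; case: l l0 => // l _; rewrite subr0.
Qed.

Lemma invqfact_rec n :
  (1 - fps_X int ^+ n.+1) * invqfact n.+1 = invqfact n.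
Proof.
have -> : 1 - fps_X int ^+ n.+1 = fps_of_poly (1 - 'X^(n.+1)).
  rewrite fps_X_exp; apply/funext => j.
  by rewrite /fps_of_poly coefB.
rewrite /invqfact {1}/qfact big_nat_recr //= -/(qfact n) fps_of_polyM.
have u1 : fps_of_poly (1 - 'X^(n.+1) : {poly int}) 0%N \is a GRing.unit.
  by rewrite /fps_of_poly coefB coef1 coefXn.
have u2 : fps_of_poly (qfact n) 0%N \is a GRing.unit.
  by rewrite /fps_of_poly qfact_coef0.
by rewrite fps_invM // mulrCA fps_invK // mulr1.
Qed.

(** All sequences of length k with entries at most N. They serve for the
    summation indices as well as for the jagged partitions, and the recursion on
    the last entry is the one that peeling follows. *)
Fixpoint boxes N k : seq (seq nat) :=
  if k is p.+1 then [seq rcons s x | s <- boxes N p, x <- iota 0 N.+1]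
  else [:: [::]].

Lemma boxesS N k :
  boxes N k.+1 = [seq rcons s x | s <- boxes N k, x <- iota 0 N.+1].
Proof. by []. Qed.

Lemma mem_boxes N k s :
  (s \in boxes N k) = (size s == k) && all (fun x => x <= N)%N s.
Proof.
elim: k s => [|k IHk] s; first by case: s.
apply/allpairsP/andP => [[[t x] []]|[]].
  rewrite /fst /snd IHk mem_iota => /andP[/eqP tk aN] /andP[_ xN] ->.
  by rewrite size_rcons tk eqxx all_rcons aN andbT.
case/lastP: s => // s x; rewrite size_rcons all_rcons => sk /andP[xN aN].
by exists (s, x); rewrite /fst /snd IHk mem_iota aN andbT; split.
Qed.

Lemma boxes_uniq N k : uniq (boxes N k).
Proof.
elim: k => // k IHk; apply: allpairs_uniq => //; first exact: iota_uniq.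
by move=> [s x] [t y] _ _ /rcons_inj[-> ->].
Qed.

Lemma perm_boxes N k :
  perm_eq [seq map val t | t : k.-tuple 'I_N.+1] (boxes N k).
Proof.
apply: uniq_perm; last 1 first.
- move=> s; rewrite mem_boxes; apply/mapP/andP => [[t _ ->]|[/eqP sk sN]].
    rewrite size_map size_tuple eqxx; split=> //.
    by apply/allP => _ /mapP[x _ ->]; exact: (ltn_ord x).
  have tk : size [seq inord x : 'I_N.+1 | x <- s] == k by rewrite size_map sk.
  exists (Tuple tk); rewrite ?mem_enum //= -map_comp -[LHS]map_id; apply/eq_in_map => x xs.
  by rewrite /= inordK // ltnS (allP sN).
- rewrite map_inj_uniq ?enum_uniq // => s t /(inj_map val_inj) st.
  exact: val_inj.
exact: boxes_uniq.
Qed.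

Section Peel.
Implicit Type s : seq nat.

Lemma entry_rcons s x j : (0 < j <= size s)%N -> entry (rcons s x) j = entry s j.
Proof. by move=> js; rewrite /entry nth_rcons ifT //; lia. Qed.

Lemma entry_rcons_last s x : entry (rcons s x) (size s).+1 = x.
Proof. by rewrite /entry /= nth_rcons ltnn eqxx. Qed.

Lemma big_entry_rcons (R : Type) (idx : R) (op : Monoid.law idx) s x
    (F : nat -> nat -> R) :
  \big[op/idx]_(1 <= j < (size s).+2) F j (entry (rcons s x) j) =
  op (\big[op/idx]_(1 <= j < (size s).+1) F j (entry s j)) (F (size s).+1 x).
Proof.
rewrite big_nat_recr //= entry_rcons_last; congr (op _ _).
by apply: eq_big_nat => j js; rewrite entry_rcons.
Qed.

Lemma Nt_rcons s x :
  Nt (size s).+2 (rcons s x) = (Nt (size s).+1 s + (size s).+1 * x)%N.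
Proof. exact: (@big_entry_rcons nat 0%N _ s x (fun j y => (j * y)%N)). Qed.

(** Sum of the squares of N_j + x, with the cross terms collected by sum_Nt_. *)
Lemma quadt_rcons s x :
  quadt (size s).+2 (rcons s x) 0 =
  (quadt (size s).+1 s 0 + (x * Nt (size s).+1 s).*2 +
   ((size s).+1 * x ^ 2 + odd (size s).+1 * x))%N.
Proof.
have N_ j : (1 <= j < (size s).+1)%N ->
    Nt_ (size s).+2 (rcons s x) j = (Nt_ (size s).+1 s j + x)%N.
  move=> js; rewrite /Nt_ big_nat_recr /=; last by lia.
  rewrite entry_rcons_last; congr (_ + _)%N; apply: eq_big_nat => l ls.
  by rewrite entry_rcons //; lia.
have odd_ : (\sum_(1 <= j < (size s).+2 | odd j) entry (rcons s x) j =
    \sum_(1 <= j < (size s).+1 | odd j) entry s j + odd (size s).+1 * x)%N.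
  rewrite big_mkcond (@big_entry_rcons nat 0%N _ s x (fun j y => if odd j then y else 0)%N).
  by rewrite [in RHS]big_mkcond; case: (odd _.+1); rewrite ?mul1n.
rewrite /quadt /Mt !subn0 odd_ big_nat_recr //=.
rewrite {2}/Nt_ big_nat1 entry_rcons_last.
under eq_big_nat => j js do rewrite N_ // sqrnD.
rewrite !big_split /= sum_nat_const_nat big1_eq -big_distrl /= sum_Nt_.
lia.
Qed.

(** The sum that defines Lt_ runs over the pairs of indices 2j, 2j+1 with
    j >= i; the truncated coefficient vanishes for smaller j, so that the sum can
    start from 0. *)
Lemma Lt_linear K s i : size s = K.-1 -> (0 < i)%N ->
  Lt_ K s i = (\sum_(1 <= l < K) (l./2.+1 - i) * entry s l)%N.
Proof.
move=> sK i0; rewrite /Lt_.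
have entry_oob l : (K <= l)%N -> entry s l = 0%N.
  by move=> Kl; rewrite /entry nth_default // sK; lia.
pose F l := ((l./2.+1 - i) * entry s l)%N.
have pairF M : (\sum_(0 <= l < M.*2) F l = \sum_(0 <= j < M) (j.+1 - i) * (entry s j.*2 + entry s j.*2.+1))%N.
  elim: M => [|M IHM]; first by rewrite !big_geq.
  rewrite doubleS !big_nat_recr //= IHM -addnA; congr (_ + _)%N.
  by rewrite /F doubleK -[(M.*2.+1)./2]/(uphalf M.*2) uphalf_double mulnDr.
case: (posnP K) => [->|K0]; first by rewrite !big_geq.
transitivity (\sum_(0 <= l < (i + K.-1).*2) F l)%N; last first.
  rewrite (@big_cat_nat _ _ _ K) //=; last by lia.
  rewrite [X in (_ + X)%N]big_nat_cond [X in (_ + X)%N]big1 ?addn0; last first.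
    by move=> l /andP[/andP[Kl _] _]; rewrite /F entry_oob ?muln0.
  have F0 : F 0%N = 0%N by rewrite /F /=; lia.
  by rewrite big_ltn // F0 add0n.
have small0 : (\sum_(0 <= j < i) (j.+1 - i) * (entry s j.*2 + entry s j.*2.+1) = 0)%N.
  rewrite big_nat_cond big1 // => j /andP[/andP[_ ji] _].
  by rewrite (_ : j.+1 - i = 0)%N //; lia.
rewrite pairF [RHS](@big_cat_nat _ _ _ i) ?leq_addr //= small0 add0n.
have shift (G : nat -> nat) :
    (\sum_(i <= j < i + K.-1) G j = \sum_(0 <= j < K.-1) G (j + i))%N.
  by rewrite -{1}[i]add0n big_addn addKn.
rewrite shift.
rewrite -(prednK K0) big_add1; apply: eq_big_nat => j _.
rewrite (_ : 2 * (i + j.+1 - 1) = (j + i).*2)%N; last by lia.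
by congr (_ * _)%N; lia.
Qed.

Lemma Lt_rcons s x i : (0 < i)%N ->
  Lt_ (size s).+2 (rcons s x) i =
  (Lt_ (size s).+1 s i + ((size s).+1./2.+1 - i) * x)%N.
Proof.
move=> i0; rewrite !Lt_linear ?size_rcons //.
exact: (@big_entry_rcons nat 0%N _ s x (fun l y => ((l./2.+1 - i) * y)%N)).
Qed.

Lemma expt_rcons s x i : (0 < i)%N ->
  expt (size s).+2 (rcons s x) 0 i =
  (expt (size s).+1 s 0 i + (halfquad (size s).+1 x +
     ((size s).+1./2.+1 - i) * x + x * Nt (size s).+1 s))%N.
Proof.
move=> i0; rewrite /expt Lt_rcons // quadt_rcons /halfquad.
set h := (_ * x ^ 2 + _)%N; have oh : ~~ odd h.
  by rewrite /h oddD !oddM oddb; case: (odd x); case: (odd _.+1).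
by rewrite !halfD odd_double (negbTE oh) !andbF doubleK; lia.
Qed.

End Peel.

Definition invprod K (s : seq nat) : fps int :=
  fps_inv (fps_of_poly (\prod_(1 <= j < K) qfact (entry s j))).

Lemma invprod_rcons s x :
  invprod (size s).+2 (rcons s x) = invprod (size s).+1 s * invqfact x.
Proof.
rewrite /invprod (@big_entry_rcons _ 1 _ s x (fun _ y => qfact y)) /=.
rewrite fps_of_polyM fps_invM // /fps_of_poly ?qfact_coef0 //.
by rewrite coef0_prod big1 // => j _; rewrite qfact_coef0.
Qed.

(** The last entry of s is the variable that peel splits off, and the exponent
    grows as in expt_rcons. *)
Lemma multisumA_boxes k i N m : (0 < i)%N -> (m <= N)%N ->
  multisumA (fps_X int) invqfact k i m =
  \sum_(s <- boxes N k | Nt k.+1 s == m)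
     fps_X int ^+ expt k.+1 s 0 i * invprod k.+1 s.
Proof.
move=> i0; elim: k m => [|k IHk] m mN.
  rewrite /= /multisumA big_mkcond big_seq1 /Nt big_geq // eq_sym.
  case: i i0 => // i _; rewrite /z_one; case: eqP => // _.
  rewrite /expt /quadt /Mt /Lt_ !big_geq //= /invprod big_geq //.
  have u1 : fps_of_poly (1 : {poly int}) 0%N \is a GRing.unit.
    by rewrite /fps_of_poly coef1.
  by rewrite expr0 mul1r -[RHS]mul1r -fps_of_poly1 fps_invK.
rewrite -[multisumA _ _ _ _]/(peel (fps_X int) invqfact k.+1 (k.+1./2.+1 - i)
  (multisumA (fps_X int) invqfact k i)) (@peel_widen _ _ _ _ _ _ _ N) //.
rewrite boxesS [RHS]big_mkcond [RHS]big_allpairs_dep.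
have -> : forall F : nat -> seq nat -> fps int,
    \sum_(s <- boxes N k) \sum_(x <- iota 0 N.+1) F x s =
    \sum_(x < N.+1) \sum_(s <- boxes N k) F x s.
  move=> F; rewrite exchange_big /= -(big_mkord xpredT (fun x => \sum_(s <- _) F x s)).
  by rewrite /index_iota subn0.
apply: eq_bigr => x _; rewrite /peel_term; case: leqP => le1; last first.
  rewrite big_seq big1 // => s; rewrite mem_boxes => /andP[/eqP sk _].
  by rewrite -sk Nt_rcons sk ifF //; lia.
rewrite IHk; last by lia.
rewrite mulr_sumr [LHS]big_mkcond big_seq [RHS]big_seq; apply: eq_bigr => s.
rewrite mem_boxes => /andP[/eqP sk _].
rewrite -sk Nt_rcons expt_rcons // invprod_rcons sk.
have -> : (Nt k.+1 s + k.+1 * x == m)%N = (Nt k.+1 s == m - k.+1 * x)%N by lia.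
by case: eqP => // ->; rewrite [in RHS]exprD; ring.
Qed.

(** Every m_j is at most the exponent of z, so a box bounded by that
    exponent carries the whole coefficient. *)
Lemma Gseries_multisum K kappa eps i n m : (0 < i)%N -> (0 < kappa)%N ->
  (eps <= 1)%N -> (2 < K)%N -> K = (2 * kappa - eps)%N ->
  Gseries K eps i n m = multisumA (fps_X int) invqfact K.-1 i m n.
Proof.
move=> i0 kappa0 eps1 K2 KE.
(* The index K - 1 dropped from the sum for eps = 1 is even. *)
have Mt_eps s : Mt K s eps = Mt K s 0.
  case: eps eps1 KE => [//|[|//]] _ KE; rewrite /Mt subn0.
  have [c Kc co] : exists2 c, K = c.+2 & ~~ odd c.+1.
    by exists (2 * kappa - 3)%N; [lia | lia].
  rewrite Kc subn1 succnK big_mkcond [RHS]big_mkcond [RHS]big_nat_recr //.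
  by rewrite (negbTE co) [RHS]addn0.
rewrite (multisumA_boxes _ i0 (leqnn m)) prednK; last by lia.
rewrite fps_sumE /Gseries.
pose r := [seq map_tuple val t | t : (K.-1).-tuple 'I_m.+1].
have rb : perm_eq [seq val t | t <- r] (boxes m K.-1).
  by rewrite -map_comp; exact: perm_boxes.
rewrite (@fsbigE _ _ _ _ _ r) //; first last.
- move=> t _ tr; rewrite /Gterm /qz_mulXz; case: (m =P Nt K t) => // mE.
  case/negP: tr; rewrite -(mem_map val_inj) (perm_mem rb) mem_boxes size_tuple eqxx.
  apply/allP => x /(nthP 0%N)[j].
  rewrite size_tuple => jK <-; rewrite mE -[nth _ _ _]/(entry t j.+1).
  by apply: entry_le_Nt; lia.
- by rewrite -(map_inj_uniq val_inj) (perm_uniq rb) boxes_uniq.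
under eq_bigl => t do rewrite in_setT.
rewrite -(perm_big _ rb) [RHS]big_map [RHS]big_mkcond /=; apply: eq_bigr => t _.
rewrite /Gterm /qz_mulXz eq_sym; case: eqP => // _.
by rewrite /expt /quadt Mt_eps fps_X_exp.
Qed.

(** * The structure of jagged partitions *)

Section Jagged.
Local Open Scope nat_scope.
Implicit Types s t : seq nat.
Local Notation "s `_ j" := (nth 0%N s j) : nat_scope.

(** Beyond the end of s the default entry 0 makes both inequalities trivial, so
    no range for j is needed. *)
Lemma jaggedP s :
  reflect [/\ forall j, s`_j.+1 <= s`_j + 1, forall j, s`_j.+2 <= s`_j
            & s = [::] \/ 0 < last 0 s] (jagged s).
Proof.
apply: (iffP and3P) => [[/allP h1 /allP h2 h3]|[h1 h2 h3]].
  split=> [j|j|]; last by case/orP: h3 => [/eqP|]; [left | right; rewrite -nth_last].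
  - have [js|sj] := ltnP j.+1 (size s); last by rewrite nth_default.
    by have := h1 j.+1; rewrite mem_iota /entry /= => /(_ _); lia.
  - have [js|sj] := ltnP j.+2 (size s); last by rewrite nth_default.
    by have := h2 j.+1; rewrite mem_iota /entry /= => /(_ _); lia.
split; last by case: h3 => [->//|]; rewrite -nth_last => ->; rewrite orbT.
  apply/allP => -[|j]; rewrite mem_iota // => _; rewrite /entry /=.
  by have := h1 j; lia.
apply/allP => -[|j]; rewrite mem_iota // => _; rewrite /entry /=; exact: h2.
Qed.

Lemma restrictedP k s : 1 < k ->
  reflect (forall j, j + k < size s -> s`_(j + k) < s`_j \/
             s`_j.+1 = s`_j + 1 /\ s`_j = s`_(j + k - 1) + 1 /\ s`_j = s`_(j + k))
    (restricted k.+1 s).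
Proof.
move=> k1; apply: (iffP allP) => [h j js|h [|j]]; last first.
- rewrite mem_iota => /andP[_ js]; have {}js : j + k < size s by lia.
  rewrite /entry /= (_ : (j.+1 + k.+1 - 1).-1 = j + k); last by lia.
  rewrite (_ : (j.+1 + k.+1 - 2).-1 = j + k - 1); last by lia.
  have [lt1|[e1 [e2 e3]]] := h j js; apply/orP; [left; lia|right].
  by rewrite -e1 eqxx -e2 -e3 !eqxx.
- by rewrite mem_iota.
have := h j.+1; rewrite mem_iota /entry /=.
rewrite (_ : (j.+1 + k.+1 - 1).-1 = j + k); last by lia.
rewrite (_ : (j.+1 + k.+1 - 2).-1 = j + k - 1); last by lia.
case/(_ _)/orP; [lia|left; lia|move=> /and3P[/eqP e1 /eqP e2 /eqP e3]].
by right; rewrite e1 -e2 -e3.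
Qed.

Definition tail01 c : seq nat := flatten (nseq c [:: 0; 1]).

Lemma size_tail01 c : size (tail01 c) = 2 * c.
Proof. by elim: c => //= c ->; lia. Qed.

Lemma nth_tail01 c j : (tail01 c)`_j = odd j && (j < 2 * c).
Proof.
elim: c j => [|c IHc] j; first by rewrite nth_nil andbF.
case: j => [|[|j]]; [by []|by rewrite mulnS|].
rewrite -[_`_ _]/((tail01 c)`_j) IHc /= negbK; congr (nat_of_bool (_ && _)); lia.
Qed.

Lemma sumn_tail01 c : sumn (tail01 c) = c.
Proof. by elim: c => //= c ->. Qed.

Lemma pairs01_cons x s : pairs01 (x :: s) = ((x == 0) && (s`_0 == 1)) + pairs01 s.
Proof.
rewrite /pairs01 /= subn1 /=; case: s => [|y s] /=; first by rewrite andbF.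
rewrite subn1 /= (iotaDl 1 1) count_map; congr (_ + _).
by apply: eq_in_count => -[|j]; rewrite mem_iota.
Qed.

Lemma pairs01_tail t c : 0 \notin t -> pairs01 (t ++ tail01 c) = c.
Proof.
elim: t => [_|x t IHt] /=; last first.
  by rewrite inE negb_or pairs01_cons => /andP[x0 /IHt ->]; rewrite eq_sym (negbTE x0).
by elim: c => //= c IHc; rewrite !pairs01_cons /= IHc.
Qed.

Lemma nth_gt0 t j : 0 \notin t -> j < size t -> 0 < t`_j.
Proof.
move=> t0 jt; rewrite lt0n; apply: contra t0 => /eqP <-; exact: mem_nth.
Qed.

Lemma last_nozero t : 0 \notin t -> t = [::] \/ 0 < last 0 t.
Proof.
case/lastP: t => [|t x]; first by left.
by rewrite mem_rcons inE negb_or last_rcons lt0n eq_sym => /andP[-> _]; right.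
Qed.

(** An entry of t is at least 1 and an entry of the appended block at most 1, so
    no inequality across the border can fail. *)
Lemma jagged_tail01 t c : 0 \notin t -> jagged (t ++ tail01 c) = jagged t.
Proof.
move=> t0; have posT := @nth_gt0 t _ t0.
apply/jaggedP/jaggedP => -[h1 h2 h3].
  split=> [j|j|]; last exact: last_nozero.
  - have [jt|tj] := ltnP j.+1 (size t); last by rewrite nth_default.
    by have := h1 j; rewrite !nth_cat jt (ltnW jt).
  - have [jt|tj] := ltnP j.+2 (size t); last by rewrite nth_default.
    by have := h2 j; rewrite !nth_cat jt (ltnW (ltnW jt)).
split=> [j|j|].
- rewrite !nth_cat !nth_tail01; have := h1 j; have := posT j.
  by case: (ltnP j); case: (ltnP j.+1); lia.
- rewrite !nth_cat !nth_tail01; have := h2 j; have := posT j.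
  by case: (ltnP j); case: (ltnP j.+2); lia.
case: c => [|c]; first by rewrite cats0.
right; rewrite -nth_last nth_cat nth_tail01 size_cat size_tail01.
by rewrite ifF; lia.
Qed.

(** After an entry 0 the next one is at most 1 and the one after it is 0 again;
    as the last entry is positive, zeros can only occur in a final run of
    pairs 01. *)
Lemma jagged_split01 s : jagged s ->
  exists t c, [/\ s = t ++ tail01 c, 0 \notin t & jagged t].
Proof.
move=> js; suff [t [c [sE t0]]] : exists t c, s = t ++ tail01 c /\ 0 \notin t.
  by exists t, c; split=> //; rewrite -(jagged_tail01 c t0) -sE.
elim: s js => [|x s IHs] /jaggedP[h1 h2 h3]; first by exists [::], 0.
have [|t [c [sE t0]]] := IHs.
  apply/jaggedP; split=> [j|j|]; [exact: (h1 j.+1)|exact: (h2 j.+1)|].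
  by case: (s) h3 => [|y s'] /=; [left|case=> // ->; right].
case: x h1 h2 h3 => [|x] h1 h2 h3; last first.
  by exists (x.+1 :: t), c; rewrite sE.
have := h1 0; have := h2 0; rewrite /= sE.
case: t t0 sE => [|y [|z t]] /=.
- case: c => [_ sE|c _ _]; first by case: h3; rewrite // sE.
  by rewrite /=.
- rewrite inE => y0 sE _ y1; exists [::], c.+1; rewrite /= (_ : y = 1) //.
  by move: y0 y1; rewrite eq_sym; case: y {sE} => [|[|y]].
- by rewrite !inE !negb_or => /and3P[_ z0 _] _; move: z0; case: z.
Qed.

(** What the study of windows needs to know about the entries 0: where the first one
    is, and that a 1 follows each of them. *)
Lemma zerosP s : jagged s -> let p := pairs01 s in
  [/\ 2 * p <= size s, 0 < p -> s`_(size s - 2 * p) = 0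
    & forall j, j < size s -> s`_j = 0 -> size s - 2 * p <= j /\ s`_j.+1 = 1].
Proof.
move=> /jagged_split01[t [c [-> t0 _]]] /=; rewrite pairs01_tail //.
rewrite size_cat size_tail01 addnK; split=> [|c0|j js]; first by rewrite leq_addl.
  by rewrite nth_cat ltnn subnn nth_tail01.
rewrite !nth_cat !nth_tail01; have := @nth_gt0 t j t0.
by case: (ltnP j); case: (ltnP j.+1); lia.
Qed.

Definition lift1 b s : seq nat := map succn s ++ nseq b 1.

Lemma size_lift1 b s : size (lift1 b s) = size s + b.
Proof. by rewrite size_cat size_map size_nseq. Qed.

Lemma nth_lift1 b s j : j < size s + b -> (lift1 b s)`_j = s`_j + 1.
Proof.
move=> js; rewrite nth_cat size_map; case: ltnP => sj.
  by rewrite (nth_map 0) // addn1.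
by rewrite nth_nseq ifT ?(nth_default _ sj) //; lia.
Qed.

Lemma sumn_lift1 b s : sumn (lift1 b s) = sumn s + size s + b.
Proof.
rewrite sumn_cat sumn_nseq mul1n; congr (_ + _).
by elim: s => //= x s ->; lia.
Qed.

Lemma lift1_nozero b s : 0 \notin lift1 b s.
Proof.
rewrite mem_cat mem_nseq andbF orbF.
by apply/negP => /mapP[].
Qed.

Lemma jagged_lift1 b s : jagged s -> jagged (lift1 b s).
Proof.
move=> /jaggedP[h1 h2 _]; apply/jaggedP; split=> [j|j|].
- have [js|sj] := ltnP j.+1 (size s + b).
    by rewrite !nth_lift1 //; [have := h1 j; lia|lia].
  by rewrite nth_default // size_lift1.
- have [js|sj] := ltnP j.+2 (size s + b).
    by rewrite !nth_lift1 //; [have := h2 j; lia|lia].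
  by rewrite nth_default // size_lift1.
exact/last_nozero/lift1_nozero.
Qed.

Definition trail1 s : nat := find (predC1 1) (rev s).

Lemma trail1_lift1 b s : jagged s -> trail1 (lift1 b s) = b.
Proof.
move=> /jaggedP[_ _ h]; rewrite /trail1 /lift1 rev_cat find_cat.
have hn : has (predC1 1) (rev (nseq b 1)) = false.
  by rewrite has_rev has_nseq andbF.
rewrite hn size_rev size_nseq -map_rev; case: h => [->|]; first by rewrite addn0.
case/lastP: s => // s [|x]; rewrite last_rcons // => _.
by rewrite rev_rcons /= addn0.
Qed.

(** The 1's that are not in the final run are followed by 2, hence lowering all
    entries in front of the final run leaves a jagged partition. *)
Lemma jagged_split1 t : jagged t -> 0 \notin t -> exists s,
  t = lift1 (trail1 t) s /\ jagged s.
Proof.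
move=> jt t0; suff [b [s [tE js]]] : exists b s, t = lift1 b s /\ jagged s.
  by exists s; rewrite tE trail1_lift1.
elim: t jt t0 => [|y t IHt] jt; first by exists 0, [::].
move: (jt) => /jaggedP[h1 h2 h3]; rewrite inE negb_or => /andP[y0 t0].
have [|b [s [tE js]]] := IHt _ t0.
  apply/jaggedP; split=> [j|j|]; [exact: (h1 j.+1)|exact: (h2 j.+1)|exact: last_nozero].
case: y y0 h1 h2 h3 {jt} => // y _ h1 h2 h3.
case: s tE js => [|x s] tE js.
  case: y h1 h2 h3 => [|y] _ _ _; first by exists b.+1, [::]; rewrite tE.
  by exists b, [:: y.+1]; rewrite tE; split.
exists b, [:: y, x & s]; split; first by rewrite tE.
move/jaggedP: js => [g1 g2 g3]; apply/jaggedP; split=> [[|j]|[|j]|].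
- by have := h1 0; rewrite /= tE /=; lia.
- exact: g1.
- have := h2 0; rewrite /= tE /=; case: (s) => //= z s' _; lia.
- exact: g2.
by right; case: g3.
Qed.

End Jagged.

(** * The K-restriction under appending pairs 01 and lifting *)

Section Restriction.
Local Open Scope nat_scope.
Implicit Types s t : seq nat.
Local Notation "s `_ j" := (nth 0%N s j) : nat_scope.

(** A window fits into the appended block iff k < 2c, and the one that starts at
    the first 0 of the block is then forbidden. Of the windows from t into the
    block, those that end in 0 are harmless, and so are those that end in 1 and
    start with an entry above 1. One that goes from 1 to 1 satisfies the
    exceptional condition when its first 1 is followed by 2, so only a start in
    the final run of 1's is forbidden. A start at distance x from the end of t
    leads to a 1 of the block iff k - x is odd and less than 2c; for
    0 < 2c <= k the smallest such x > 0 is k - 2c + 1. *)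
Lemma restricted_tail01 k t c : 1 < k -> jagged t -> 0 \notin t ->
  restricted k.+1 (t ++ tail01 c) =
  restricted k.+1 t && (trail1 t + 2 * c <= k).
Proof.
move=> k1 jt t0; have [s [tE js]] := jagged_split1 jt t0.
set b := trail1 t in tE *.
have st : size t = size s + b by rewrite tE size_lift1.
have nt j : j < size t -> t`_j = s`_j + 1 by rewrite st tE; exact: nth_lift1.
have [_ _ zs] := zerosP js.
set r := t ++ tail01 c.
have sr : size r = size t + 2 * c by rewrite size_cat size_tail01.
have rin j : j < size t -> r`_j = t`_j by move=> jt'; rewrite nth_cat jt'.
have rout j : size t <= j -> r`_j = odd (j - size t) && (j - size t < 2 * c).
  by move=> tj; rewrite nth_cat ltnNge tj /= nth_tail01.
have t1 j : size s <= j -> j < size t -> t`_j = 1.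
  by move=> sj jt'; rewrite nt // nth_default.
apply/(restrictedP _ k1)/andP => [h|[/(restrictedP _ k1) h bk] j jr].
  split.
    apply/(restrictedP _ k1) => j js'; have := h j.
    by rewrite !rin; lia.
  (* Otherwise some window is too long: inside the block of pairs, inside the
     final run of 1's, or from that run to the last entry of the block. *)
  rewrite leqNgt; apply/negP => kb.
  have [k2c|c2k] := ltnP k (2 * c).
    by have := h (size t); rewrite !rout; lia.
  have [c0|c0] := posnP c.
    by have := h (size s); rewrite !rin ?t1; lia.
  have := h (size t - (k - 2 * c + 1)).
  have e1 : size t - (k - 2 * c + 1) + k = size t + (2 * c - 1) by lia.
  rewrite e1 [r`_(size t + (2 * c - 1))]rout ?[r`_(size t - _)]rin; try lia.
  rewrite t1; try lia.
  have [kc|kc] := ltnP (2 * c) k.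
    rewrite rin ?t1; try lia.
  rewrite rout; lia.
have [jk|kj] := ltnP (j + k) (size t).
  have := h j jk; rewrite !rin //; lia.
have jt' : j < size t by lia.
have p0 := nth_gt0 t0 jt'.
rewrite (rout _ kj) (rin _ jt').
have [ev|od] := boolP (~~ odd (j + k - size t)); first by left; rewrite (negbTE ev).
have [lt1|le1] := ltnP 1 (t`_j); first by left; lia.
have tj1 : t`_j = 1 by lia.
have [sj|jss] := leqP (size s) j; first by lia.
have [|_ s1] := zs j jss; first by have := nt j jt'; lia.
right; rewrite [r`_(j + k - 1)]rout; last by lia.
have jS : j.+1 < size t by case: (ltnP j.+1 (size s)) => [|/(nth_default 0)]; lia.
by rewrite rin // nt //; split; lia.
Qed.

(** A window that ends in the appended 1's violates the restriction iff it starts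
    with 1: the exceptional condition would require an entry 0. The first 1 of
    the lifted sequence is at distance 2 (pairs01 s) from the end of s. *)
Lemma restricted_lift1 k s b : 1 < k -> jagged s ->
  restricted k.+1 (lift1 b s) =
  restricted k.+1 s && (2 * pairs01 s + b <= k).
Proof.
move=> k1 js; have [ps s0 zs] := zerosP js.
set p := pairs01 s in ps s0 zs *; set t := lift1 b s.
have st : size t = size s + b by rewrite size_lift1.
have nt j : j < size t -> t`_j = s`_j + 1 by rewrite st; exact: nth_lift1.
apply/(restrictedP _ k1)/andP => [h|[/(restrictedP _ k1) h bk] j jt].
  split.
    apply/(restrictedP _ k1) => j jss; have := h j.
    by rewrite !nt; lia.
  rewrite leqNgt; apply/negP => kb.
  (* For p = 0 this position is just past the end of s. *)
  have z : s`_(size s - 2 * p) = 0.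
    by have [p0|/s0 //] := posnP p; rewrite nth_default // p0; lia.
  have := h (size s - 2 * p); rewrite !nt ?z; lia.
have [jk|kj] := ltnP (j + k) (size s).
  have := h j jk; rewrite !nt; lia.
have jss : j < size s by lia.
rewrite !nt; try lia.
rewrite (nth_default 0 kj).
have [z|nz] := posnP (s`_j); last by left; lia.
by have [] := zs j jss z; lia.
Qed.

End Restriction.

(** * The generating functions of restricted jagged partitions *)

Section Counting.
Local Open Scope nat_scope.
Implicit Types s t : seq nat.

Lemma cat_suffix_inj (T : Type) (r : seq T) : injective (fun s : seq T => s ++ r).
Proof.
apply: (can_inj (g := fun s : seq T => take (size s - size r) s)) => s.
by rewrite size_cat addnK take_size_cat.
Qed.

(** A sequence of sum n has entries at most n, so the bound in boxes n m does not
    affect such counts. *)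
Lemma count_boxes_bij (P P' : pred (seq nat)) (f : seq nat -> seq nat) n m n' m' :
  injective f ->
  (forall s, P s -> sumn s = n) -> (forall s, P' s -> sumn s = n') ->
  (forall s, size s = m -> P s -> exists t, [/\ s = f t, size t = m' & P' t]) ->
  (forall t, size t = m' -> P' t -> size (f t) = m /\ P (f t)) ->
  count P (boxes n m) = count P' (boxes n' m').
Proof.
move=> fI Pn Pn' Pf Pf'.
have box (Q : pred (seq nat)) a l s : (forall s, Q s -> sumn s = a) ->
    (s \in [seq s <- boxes a l | Q s]) = Q s && (size s == l).
  move=> Qa; rewrite mem_filter mem_boxes.
  have [Qs|//] := boolP (Q s); rewrite -(Qa s Qs) /=; case: eqP => //= _.
  apply/allP => x; elim: (s) => //= y t IHt; rewrite inE => /orP[/eqP ->|/IHt].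
    exact: leq_addr.
  by move/leq_trans; apply; exact: leq_addl.
rewrite -!size_filter -[RHS](size_map f); apply/perm_size/uniq_perm.
- by rewrite filter_uniq // boxes_uniq.
- by rewrite map_inj_uniq // filter_uniq // boxes_uniq.
move=> s; rewrite box //; apply/andP/mapP => [[Ps /eqP sm]|[t]].
  by have [t [-> tm Pt]] := Pf s sm Ps; exists t; rewrite // box // Pt tm eqxx.
by rewrite box // => /andP[Pt /eqP tm] ->; have [-> ->] := Pf' t tm Pt.
Qed.

Lemma count_ltnS (T : Type) (a : pred T) (f : T -> nat) i r :
  count (fun x => a x && (f x < i.+1)) r =
  count (fun x => a x && (f x < i)) r + count (fun x => a x && (f x == i)) r.
Proof.
by elim: r => //= x r ->; case: (a x) => //=; lia.
Qed.

Variable k : nat.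
Hypothesis k1 : 1 < k.

Definition countA i m n : nat :=
  count (fun s => [&& jagged s, restricted k.+1 s & sumn s == n] &&
                  (pairs01 s < i)) (boxes n m).

Definition countE b m n : nat :=
  count (fun t => [&& jagged t, 0 \notin t, restricted k.+1 t & sumn t == n] &&
                  (trail1 t < b)) (boxes n m).

(** Those with exactly i pairs 01 arise by appending tail01 i. *)
Lemma countAS i m n : countA i.+1 m n = countA i m n +
  if (2 * i <= m) && (i <= n) then countE (k.+1 - 2 * i) (m - 2 * i) (n - i)
  else 0.
Proof.
rewrite /countA count_ltnS; congr (_ + _).
have split s : jagged s -> pairs01 s = i ->
    exists t, [/\ s = t ++ tail01 i, 0 \notin t & jagged t].
  move=> /jagged_split01[t [c [-> t0 jt]]]; rewrite pairs01_tail // => <-.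
  by exists t.
case: ifP => [/andP[im i_n]|imn].
  apply: (@count_boxes_bij _ _ (fun t => t ++ tail01 i)).
  - exact: cat_suffix_inj.
  - by move=> s /andP[/and3P[_ _ /eqP]].
  - by move=> s /andP[/and4P[_ _ _ /eqP]].
  - move=> s sm /andP[/and3P[js rs /eqP sn] /eqP /split[//|t [sE t0 jt]]].
    exists t; move: sm rs sn.
    rewrite sE size_cat size_tail01 sumn_cat sumn_tail01 restricted_tail01 //.
    move=> sm /andP[rt bk] sn; split=> //; first by lia.
    by rewrite jt t0 rt /=; apply/andP; split; lia.
  - move=> t tm /andP[/and4P[jt t0 rt /eqP tn] bk].
    rewrite size_cat size_tail01 jagged_tail01 // jt restricted_tail01 // rt /=.
    by rewrite sumn_cat sumn_tail01 pairs01_tail // eqxx; split; lia.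
rewrite (@eq_in_count _ _ pred0) ?count_pred0 // => s; rewrite mem_boxes.
move=> /andP[/eqP sm _]; apply/negP => /andP[/and3P[js _ /eqP sn] /eqP].
case/split => // t [sE _ _]; move: sm sn.
by rewrite sE size_cat size_tail01 sumn_cat sumn_tail01; lia.
Qed.

(** Those with exactly b final 1's arise by lift1 b from sequences of length
    m - b, which adds (m - b) + b = m to the sum. *)
Lemma countES b m n : countE b.+1 m n = countE b m n +
  if (b <= m) && (m <= n) then countA (k.+2 - b)./2 (m - b) (n - m) else 0.
Proof.
rewrite /countE count_ltnS; congr (_ + _).
case: ifP => [/andP[bm mn]|bmn].
  apply: (@count_boxes_bij _ _ (lift1 b)).
  - by move=> s t /cat_suffix_inj/(inj_map succn_inj).
  - by move=> s /andP[/and4P[_ _ _ /eqP]].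
  - by move=> s /andP[/and3P[_ _ /eqP]].
  - move=> t tm /andP[/and4P[jt t0 rt /eqP tn] /eqP tb].
    have [s [tE js]] := jagged_split1 jt t0; rewrite tb in tE.
    exists s; move: tm rt tn.
    rewrite tE size_lift1 sumn_lift1 restricted_lift1 // => tm /andP[rs pk] tn.
    split=> //; first by lia.
    by rewrite js rs /=; apply/andP; split; lia.
  - move=> s sm /andP[/and3P[js rs /eqP sn] pk].
    rewrite size_lift1 jagged_lift1 // lift1_nozero restricted_lift1 // rs /=.
    by rewrite sumn_lift1 trail1_lift1 // eqxx; split; lia.
rewrite (@eq_in_count _ _ pred0) ?count_pred0 // => t; rewrite mem_boxes.
move=> /andP[/eqP tm _]; apply/negP => /andP[/and4P[jt t0 _ /eqP tn] /eqP tb].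
have [s [tE js]] := jagged_split1 jt t0; rewrite tb in tE; move: tm tn.
by rewrite tE size_lift1 sumn_lift1; lia.
Qed.

Lemma countA0 m n : countA 0 m n = 0.
Proof.
by rewrite /countA (@eq_count _ _ pred0) ?count_pred0 // => s; rewrite ltn0 andbF.
Qed.

Lemma countE0 m n : countE 0 m n = 0.
Proof.
by rewrite /countE (@eq_count _ _ pred0) ?count_pred0 // => s; rewrite ltn0 andbF.
Qed.

Lemma countA_nil i n : countA i 0 n = (0 < i) && (n == 0).
Proof.
by rewrite /countA /= addn0 /restricted /= eq_sym andbC.
Qed.

End Counting.

Definition fpsA k i : nat -> fps int := fun m n => (countA k i m n)%:Z.
Definition fpsE k b : nat -> fps int := fun m n => (countE k b m n)%:Z.

Lemma count_ladder k : (1 < k)%N -> ladder (fps_X int) k (fpsA k) (fpsE k).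
Proof.
move=> k1; split=> [| |i|b].
- by apply/funext => m; apply/funext => n; rewrite /fpsA countA0.
- by apply/funext => m; apply/funext => n; rewrite /fpsE countE0.
- apply/funext => m; apply/funext => n.
  rewrite addfE [RHS]addfE /mon /fpsA countAS // PoszD; congr (_ + _).
  case: leqP => //= im; rewrite fps_coefXnM.
  by case: leqP.
apply/funext => m; apply/funext => n.
rewrite addfE [RHS]addfE /mon /fpsE countES // PoszD; congr (_ + _).
case: leqP => //= im; rewrite /dil mulrA -exprD subnKC // fps_coefXnM.
by case: leqP.
Qed.

(** Induction on the exponent n of q. The relation for E lowers n by m, the one
    for A by i; when m = 0 the former refers to the given constant terms, and
    when i = 0 the latter refers to E at the same n, which is treated first. *)
Lemma ladder_unique k (A E A' E' : nat -> nat -> fps int) :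
  ladder (fps_X int) k A E -> ladder (fps_X int) k A' E' ->
  (forall i, A i 0%N = A' i 0%N) -> forall i m, A i m = A' i m.
Proof.
move=> [A0 E0 RA RE] [A0' E0' RA' RE'] A00.
suff H n : forall m, (forall i, A i m n = A' i m n) /\ (forall b, E b m n = E' b m n).
  by move=> i m; apply/funext => n; have [] := H n m.
elim/ltn_ind: n => n IH m.
have HE b : E b m n = E' b m n.
  elim: b => [|b IHb]; first by rewrite E0 E0'.
  rewrite RE RE' !addfE IHb; congr (_ + _).
  rewrite /mon; case: leqP => // bm.
  rewrite /dil !mulrA -!exprD subnKC // !fps_coefXnM; case: leqP => // mn.
  have [m0|m0] := posnP m.
    by rewrite (_ : m - b = 0)%N ?A00 //; lia.
  by have [|-> _] := IH (n - m)%N _ (m - b)%N; lia.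
split=> //; elim=> [|i IHi]; first by rewrite A0 A0'.
rewrite RA RA' !addfE IHi; congr (_ + _).
rewrite /mon; case: leqP => // im; rewrite !fps_coefXnM; case: leqP => // i_n.
have [->|i0] := posnP i; first by rewrite !subn0 HE.
by have [|_ ->] := IH (n - i)%N _ (m - 2 * i)%N; lia.
Qed.

Lemma Jcount_countA k i n m : (0 < i)%N -> Jcount k.+1 i n m = countA k i m n.
Proof.
move=> i0; rewrite /Jcount /countA cardsE cardE size_filter.
rewrite -(permP (perm_boxes n m)) count_map enumT; apply: eq_count => t.
have iE a : (a <= i - 1)%N = (a < i)%N by lia.
(* Membership in the finite set is only reached through conversion. *)
suff: [&& jagged (map val t), restricted k.+1 (map val t),
        sumn (map val t) == n & (pairs01 (map val t) <= i - 1)%N] =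
      [&& jagged (map val t), restricted k.+1 (map val t) & sumn (map val t) == n] &&
      (pairs01 (map val t) < i)%N by [].
by rewrite iE -!andbA.
Qed.

(** In degree 0 only the zero summation indices contribute. *)
Lemma multisumA_z0 k i : multisumA (fps_X int) invqfact k i 0%N = (0 < i)%:R.
Proof.
have u0 : invqfact 0 = 1.
  have q1 : qfact 0 = 1 by rewrite /qfact big_geq.
  rewrite /invqfact q1 -[LHS]mul1r -fps_of_poly1 fps_invK //.
  by rewrite /fps_of_poly coef1.
elim: k i => [[|i] //|k IHk i].
have -> : multisumA (fps_X int) invqfact k.+1 i = peel (fps_X int) invqfact k.+1
   (k.+1./2.+1 - i) (multisumA (fps_X int) invqfact k i) by [].
rewrite /peel big_ord1 /peel_term muln0 /= subn0 u0 IHk.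
by rewrite /halfquad !muln0 expr0 !mul1r.
Qed.

(** * Equality of the two series *)

Theorem proposition4 (K i kappa eps : nat) :
  (0 < K)%N -> (0 < i)%N -> (0 < kappa)%N -> eps = 0%N \/ eps = 1%N ->
  (2 < K)%N -> K = (2 * kappa - eps)%N -> (1 <= i <= kappa)%N ->
  Gseries K eps i = Jseries K i.
Proof.
move=> K0 i0 kappa0 eps01 K2 KE _.
have eps1 : (eps <= 1)%N by case: eps01 => ->.
have k1 : (1 < K.-1)%N by lia.
apply/funext => n; apply/funext => m.
rewrite (Gseries_multisum _ _ i0 kappa0 eps1 K2 KE) /Jseries.
rewrite -(prednK K0) Jcount_countA //= -[RHS]/(fpsA K.-1 i m n).
congr (_ n); apply: (ladder_unique (multisum_ladder invqfact_rec _) (count_ladder k1)).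
move=> j; rewrite multisumA_z0; apply/funext => l.
rewrite /fpsA countA_nil; case: j => //= j.
by rewrite -[LHS]/((1 : {poly int})`_l) coef1; case: eqP.
Qed.
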